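(* Let $\mathcal{A}$ be the infinitesimal generator of a birth--death process on $\mathbb{N}_0$ with rates $\{\lambda_n,\mu_n\}$ ($\lambda_n>0$ for $n\ge 0$, $\mu_n>0$ for $n\ge1$, $\mu_0\ge0$). Consider the UL factorization $\mathcal{A}=\mathcal{A}_U\mathcal{A}_L$, where $\mathcal{A}_U$ is upper bidiagonal with diagonal $(y_n)_{n\ge0}$ and superdiagonal $(x_n)_{n\ge0}$, and $\mathcal{A}_L$ is lower bidiagonal with diagonal $(s_n)_{n\ge0}$ and subdiagonal $(r_n)_{n\ge1}$, the coefficients being given by the explicit formulas (depending on the free parameter $x_0$ and on $\tilde\mu_0$) recorded in the context. Let $\widetilde{\mathcal{A}}=\mathcal{A}_L\mathcal{A}_U$ be the Darboux transform of $\mathcal{A}$, and define $$T=\sum_{n=0}^\infty\pi_nu_n^2=\sum_{n=0}^\infty\pi_n\left(1+(\mu_0-x_0-\tilde\mu_0)\sum_{k=0}^{n-1}\frac{1}{\lambda_k\pi_k}\right)^2>1,\qquad A=\sum_{n=0}^\infty\frac1{\lambda_n\pi_n}.$$ Then $\widetilde{\mathcal{A}}$ is the infinitesimal generator of a birth--death process on $\mathbb{N}_0$ with absorption rate $\tilde\mu_0$ and birth and death rates $$\tilde\lambda_0=x_0,\quad \tilde\mu_1=\lambda_0u_1\frac{x_0+\tilde\mu_0}{x_0},\qquad \tilde\lambda_n=\lambda_{n-1}\frac{x_n}{x_{n-1}},\quad \tilde\mu_{n+1}=\frac{\lambda_n\mu_n}{\lambda_{n-1}}\cdot\frac{u_{n+1}u_{n-1}}{u_n^2}\cdot\frac{x_{n-1}}{x_n}\quad(n\ge1),$$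 if and only if one of the following two situations holds: (1) $T=\infty$, $\tilde\mu_0=0$, and the free parameter $x_0$ satisfies $0<x_0\le\mu_0+\dfrac1A$; (2) $T<\infty$, and the free parameter $x_0>0$ and the absorption rate $\tilde\mu_0\ge0$ satisfy $\tilde\mu_0\,T\le x_0+\tilde\mu_0\le\mu_0+\dfrac1A$. (Here $1/A=0$ if $A=\infty$.)
   Context: Infinitesimal generator of a birth--death process on $\mathbb{N}_0$ with rates $\{\lambda_n,\mu_n\}$: the semi-infinite tridiagonal matrix $\mathcal{A}$ with entries $\mathcal{A}_{n,n+1}=\lambda_n>0$ ($n\ge0$), $\mathcal{A}_{n,n-1}=\mu_n>0$ ($n\ge1$), $\mathcal{A}_{n,n}=-(\lambda_n+\mu_n)$ ($n\ge0$), with $\mu_0\ge0$, and all other entries $0$. The number $\mu_0$ is the absorption rate (from state $0$ to an absorbing state $-1$). Thus a tridiagonal matrix $\widetilde{\mathcal{A}}$ is the generator of a birth--death process with absorption rate $\tilde\mu_0$ iff its off-diagonal entries (next to the diagonal) are all positive, $\tilde\mu_0\ge0$, its first row sums to $-\tilde\mu_0$ and all its other rows sum to $0$. Potential coefficients: $\pi_0=1$, $\pi_n=\dfrac{\lambda_0\cdots\lambda_{n-1}}{\mu_1\cdots\mu_n}$ for $n\ge1$. Let $x_0$ (the free parameter) and $\tilde\mu_0$ be real numbers with $x_0\ne0$ and $\tilde\mu_0\ge0$. Put $$u_n=1+(\mu_0-x_0-\tilde\mu_0)\sum_{k=0}^{n-1}\frac1{\lambda_k\pi_k}\quad(n\ge0),\qquad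 E_n=x_0+\tilde\mu_0-\tilde\mu_0\sum_{k=0}^n\pi_ku_k^2\quad(n\ge-1),$$ so $u_0=1$, $E_{-1}=x_0+\tilde\mu_0$, $E_0=x_0$. Coefficients of the UL factorization: $$x_n=\frac{E_n}{\pi_nu_n},\quad y_n=-\frac{E_{n-1}}{\pi_nu_n}\quad(n\ge0),\qquad s_0=1,\quad s_n=\frac{\lambda_{n-1}\pi_{n-1}u_{n-1}}{E_{n-1}},\quad r_n=-\frac{\mu_n\pi_nu_n}{E_{n-1}}\quad(n\ge1).$$ It is a standing assumption that the factorization makes sense, i.e. $u_n\ne0$ and $x_n\neq0$ for all $n\ge0$. *)

(* Defs.v *)
From HB Require Import structures.
From mathcomp Require Import all_boot all_order all_algebra.
From mathcomp Require Import all_classical all_reals all_analysis.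

Set Implicit Arguments.
Unset Strict Implicit.
Unset Printing Implicit Defensive.

Import Order.TTheory GRing.Theory Num.Theory.
Import numFieldNormedType.Exports.

Local Open Scope classical_set_scope.
Local Open Scope ring_scope.

Section SemiInfiniteMatrices.
Variable R : realType.

Definition imatrix := nat -> nat -> R.

(* The sum ranges over all k in nat and is finitely supported as soon as the
   rows of M (or the columns of N) are, which is the case for band matrices;
   it would be 0 on an infinite support. *)
Definition imulmx (M N : imatrix) : imatrix :=
  fun i j => \sum_(k \in [set: nat]) (M i k * N k j).

Definition upper_bidiag (d sup : nat -> R) : imatrix := fun i j =>
  if j == i then d i else if j == i.+1 then sup i else 0.

(* sub i is the entry (i, i - 1); the value sub 0 is never used. *)
Definition lower_bidiag (d sub : nat -> R) : imatrix := fun i j =>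
  if j == i then d i else if i == j.+1 then sub i else 0.

Definition bd_rates (lam mu : nat -> R) : Prop :=
  [/\ forall n, 0 < lam n, forall n, 0 < mu n.+1 & 0 <= mu 0%N].

Definition bd_matrix (lam mu : nat -> R) : imatrix := fun i j =>
  if j == i.+1 then lam i
  else if i == j.+1 then mu i
  else if j == i then - (lam i + mu i)
  else 0.

(* M generates the birth-death process with birth rates lam n (n >= 0), death
   rates mu n (n >= 1) and absorption rate mu 0. *)
Definition is_bd_generator (M : imatrix) (lam mu : nat -> R) : Prop :=
  bd_rates lam mu /\ M =2 bd_matrix lam mu.

End SemiInfiniteMatrices.

Section ULCoefficients.
Variables (R : realType) (lam mu : nat -> R).

Definition potential (n : nat) : R :=
  (\prod_(k < n) lam k) / (\prod_(k < n) mu k.+1).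

Definition sum_A : \bar R :=
  (\sum_(0 <= n <oo) ((lam n * potential n)^-1)%:E)%E.

Variables (x0 mut0 : R).

Definition ul_u (n : nat) : R :=
  1 + (mu 0%N - x0 - mut0) * \sum_(k < n) (lam k * potential k)^-1.

Definition sum_T : \bar R :=
  (\sum_(0 <= n <oo) (potential n * ul_u n ^+ 2)%:E)%E.

(* Index shift: ul_Epred n is E_(n-1), so that the index -1 is available. *)
Definition ul_Epred (n : nat) : R :=
  x0 + mut0 - mut0 * \sum_(k < n) potential k * ul_u k ^+ 2.

Definition ul_E (n : nat) : R := ul_Epred n.+1.

Definition ul_x (n : nat) : R := ul_E n / (potential n * ul_u n).

Definition ul_y (n : nat) : R := - (ul_Epred n / (potential n * ul_u n)).

Definition ul_s (n : nat) : R :=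
  if n is m.+1 then lam m * potential m * ul_u m / ul_E m else 1.

(* Only meaningful for n >= 1. *)
Definition ul_r (n : nat) : R :=
  - (mu n * potential n * ul_u n / ul_Epred n).

Definition ul_AU : imatrix R := upper_bidiag ul_y ul_x.

Definition ul_AL : imatrix R := lower_bidiag ul_s ul_r.

Definition darboux : imatrix R := imulmx ul_AL ul_AU.

Definition darboux_lam (n : nat) : R :=
  if n is m.+1 then lam m * (ul_x m.+1 / ul_x m) else x0.

(* In the last branch n = m.+1 >= 1 and the value is the rate of index n + 1. *)
Definition darboux_mu (i : nat) : R :=
  match i with
  | 0%N => mut0
  | 1%N => lam 0%N * ul_u 1 * ((x0 + mut0) / x0)
  | (m.+1 as n).+1 =>
      lam n * mu n / lam m * (ul_u n.+1 * ul_u m / ul_u n ^+ 2)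
      * (ul_x m / ul_x n)
  end.

End ULCoefficients.

(* Main.v *)
Require Import Defs.
From HB Require Import structures.
From mathcomp Require Import all_boot all_order all_algebra.
From mathcomp Require Import all_classical all_reals all_analysis.
From mathcomp Require Import ring lra.

Set Implicit Arguments.
Unset Strict Implicit.
Unset Printing Implicit Defensive.

Import Order.TTheory GRing.Theory Num.Theory.
Import numFieldNormedType.Exports.

Local Open Scope classical_set_scope.
Local Open Scope ring_scope.

(** Both matrix identities hold as soon as the factorization makes sense,
    whatever the signs of u_n and E_n. The increments c / (lam_n pi_n) of u,
    with c = mu_0 - x_0 - mut_0, carry a constant flux c, so that u is harmonic
    for the generator in all rows but the first, where the value of c gives the
    right diagonal entry: this is A = A_U A_L. In the other product,
    E_(n-1) - E_n = mut_0 pi_n u_n^2 makes every row but the first of A_L A_U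
    sum to zero. So A_L A_U is always the tridiagonal matrix with the stated
    entries ([darboux_tridiagonal]), and what remains is to decide when these
    entries are admissible rates.

    The birth rates are all positive iff all x_n = E_n / (pi_n u_n) are, that
    is, iff u_n and E_n always have the same sign. Since
    mut_(n+1) = lam_n u_(n+1) E_(n-1) / (u_n E_n), the positivity of the death
    rates then says that E_(n-1) and E_(n+1) have the same sign. Starting from
    E_(-1) = x_0 + mut_0 > 0 and E_0 = x_0 > 0, all E_n, hence all u_n, are
    positive ([darboux_rates_iff]).

    Both families of inequalities have the shape b * (partial sum) < a, with
    positive terms under the sum. Partial sums increase strictly, so this holds
    for all of them iff b * (infinite sum) <= a ([partial_sums_ltP]). With the
    terms pi_n u_n^2 the condition on E becomes mut_0 T <= x_0 + mut_0, which
    forces mut_0 = 0 when T is infinite; with the terms 1 / (lam_n pi_n) the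
    condition on u becomes (x_0 + mut_0 - mu_0) A <= 1. *)

(** * Products with bidiagonal matrices *)

Lemma eqn_nearF k :
  (((k.+1 == k) = false) * ((k == k.+1) = false))
  * (((k.+2 == k) = false) * ((k == k.+2) = false)).
Proof.
by do 2!split; rewrite ?(gtn_eqF (leqnSn _)) ?(ltn_eqF (leqnSn _))
  ?(gtn_eqF (ltnSn _)) ?(ltn_eqF (ltnSn _)).
Qed.

Section BidiagonalProducts.
Variable R : realType.
Implicit Types (d e : nat -> R) (N : imatrix R).

Lemma imulmx_upper_bidiag d e N i j :
  imulmx (upper_bidiag d e) N i j = d i * N i j + e i * N i.+1 j.
Proof.
rewrite /imulmx (fsbigE [:: i; i.+1]) //=; first last.
- move=> k _ /=; rewrite !inE /upper_bidiag.
  by case: eqVneq => //= _; case: eqVneq => //= _; rewrite mul0r.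
- by rewrite inE neq_ltn ltnSn.
rewrite !big_cons big_nil !in_setT /upper_bidiag eqxx eqn_leq ltnn /=.
by rewrite eqxx addr0.
Qed.

Lemma imulmx_lower_bidiag0 d e N j :
  imulmx (lower_bidiag d e) N 0 j = d 0%N * N 0%N j.
Proof.
rewrite /imulmx (fsbigE [:: 0%N]) //=; first last.
- move=> k _ /=; rewrite !inE /lower_bidiag.
  by case: eqVneq => //= _; rewrite mul0r.
by rewrite big_cons big_nil in_setT /lower_bidiag eqxx addr0.
Qed.

Lemma imulmx_lower_bidiagS d e N i j :
  imulmx (lower_bidiag d e) N i.+1 j = d i.+1 * N i.+1 j + e i.+1 * N i j.
Proof.
rewrite /imulmx (fsbigE [:: i.+1; i]) //=; first last.
- move=> k _ /=; rewrite !inE /lower_bidiag eqSS (eq_sym i k).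
  by case: eqVneq => //= _; case: eqVneq => //= _; rewrite mul0r.
- by rewrite inE neq_ltn ltnSn orbT.
rewrite !big_cons big_nil !in_setT /lower_bidiag eqxx (@eqn_leq i i.+1) ltnn.
by rewrite andbF addr0.
Qed.

End BidiagonalProducts.

(** * Bounds on all partial sums of a positive series *)

Section PartialSums.
Variable R : realType.

(** The strict bounds become a non-strict one in the limit; conversely a
    non-strict bound on the sum is strict on each partial sum because the next
    term is positive. The sum may be infinite, and b of any sign: for b <= 0
    both sides hold, with the convention 0 * +oo = 0. *)
Lemma partial_sums_ltP (f : nat -> R) (a b : R) :
  (forall n, 0 < f n) -> 0 < a ->
  (forall n, b * \sum_(k < n) f k < a) <->
  (b%:E * \sum_(0 <= k <oo) (f k)%:E <= a%:E)%E.
Proof.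
move=> f_gt0 a_gt0.
have f_ge0 k : (0 <= (f k)%:E)%E by rewrite lee_fin ltW.
set S := (\sum_(0 <= k <oo) _)%E.
have S_ge n : ((\sum_(k < n) f k)%:E <= S)%E.
  rewrite -sumEFin -(big_mkord xpredT (fun k => (f k)%:E)).
  exact: nneseries_lim_ge.
have S_ge0 : (0 <= S)%E by apply: nneseries_ge0.
have [b_le0|b_gt0] := leP b 0.
  split=> _.
    apply: (@le_trans _ _ 0%E); first by rewrite mule_le0_ge0 ?lee_fin.
    by rewrite lee_fin ltW.
  move=> n; apply: le_lt_trans a_gt0; apply: mulr_le0_ge0 => //.
  by apply: sumr_ge0 => k _; exact: ltW.
split=> [lt_a|le_a n].
  rewrite -lee_pdivlMl//; apply: lime_le; first exact: is_cvg_nneseries.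
  apply: nearW => n; rewrite big_mkord sumEFin lee_fin.
  by rewrite ler_pdivlMl// ltW.
have lt_sum : \sum_(k < n) f k < \sum_(k < n.+1) f k.
  by rewrite big_ord_recr /= ltrDl.
rewrite -(ltr_pM2l b_gt0) in lt_sum; apply: (lt_le_trans lt_sum).
rewrite -lee_fin EFinM; apply: le_trans le_a.
by rewrite lee_pmul2l// S_ge.
Qed.

(** The extreme values are harmless: S = 0 has inverse +oo, and for S = +oo both
    sides say b <= 0. *)
Lemma lee_fin_inv (b : R) (S : \bar R) : (0 <= S)%E ->
  (b%:E <= S^-1)%E = (b%:E * S <= 1)%E.
Proof.
move=> S_ge0; have [b_le0|b_gt0] := leP b 0.
  transitivity true; last apply/esym.
    by apply: (@le_trans _ _ 0%E); rewrite ?lee_fin// inve_ge0.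
  by apply: (@le_trans _ _ 0%E); first rewrite mule_le0_ge0 ?lee_fin.
rewrite -lee_pdivlMl// mule1 -{1}[b]invrK.
have -> : ((b^-1)^-1)%:E = ((b^-1)%:E^-1)%E :> \bar R.
  by rewrite inver invr_eq0 gt_eqF.
by rewrite lee_pV2// inE lee_fin invr_ge0 ltW.
Qed.

End PartialSums.

(** * The UL factorization and its Darboux transform *)

Section ULFactorization.
Variables (R : realType) (lam mu : nat -> R) (x0 mut0 : R).
Hypothesis rates : bd_rates lam mu.
Local Notation p := (potential lam mu).
Local Notation u := (ul_u lam mu x0 mut0).
Local Notation Ep := (ul_Epred lam mu x0 mut0).
Local Notation x := (ul_x lam mu x0 mut0).
Local Notation y := (ul_y lam mu x0 mut0).
Local Notation s := (ul_s lam mu x0 mut0).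
Local Notation r := (ul_r lam mu x0 mut0).

Let lam_gt0 n : 0 < lam n. Proof. by case: rates. Qed.
Let mu_gt0 n : 0 < mu n.+1. Proof. by case: rates. Qed.
Let lam_neq0 n : lam n != 0. Proof. by rewrite gt_eqF. Qed.
Let mu_neq0 n : mu n.+1 != 0. Proof. by rewrite gt_eqF. Qed.

Lemma potential_gt0 n : 0 < p n.
Proof. by rewrite divr_gt0// prodr_gt0. Qed.

Let p_neq0 n : p n != 0. Proof. by rewrite gt_eqF// potential_gt0. Qed.

Lemma potential0 : p 0 = 1.
Proof. by rewrite /potential !big_ord0 divr1. Qed.

Lemma potentialS n : p n.+1 = p n * (lam n / mu n.+1).
Proof. by rewrite /potential !big_ord_recr /= invfM mulrACA. Qed.

Lemma ul_u0 : u 0 = 1.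
Proof. by rewrite /ul_u big_ord0 mulr0 addr0. Qed.

Lemma ul_uS n : u n.+1 = u n + (mu 0%N - x0 - mut0) / (lam n * p n).
Proof. by rewrite /ul_u big_ord_recr /= mulrDr addrA. Qed.

Lemma ul_Epred0 : Ep 0 = x0 + mut0.
Proof. by rewrite /ul_Epred big_ord0 mulr0 subr0. Qed.

Lemma ul_EpredS n : Ep n.+1 = Ep n - mut0 * (p n * u n ^+ 2).
Proof. by rewrite /ul_Epred big_ord_recr /=; ring. Qed.

Lemma ul_Epred1 : Ep 1 = x0.
Proof. by rewrite ul_EpredS ul_Epred0 potential0 ul_u0; ring. Qed.

Lemma ul_x0 : x 0 = x0.
Proof. by rewrite /ul_x /ul_E ul_Epred1 potential0 ul_u0 mulr1 divr1. Qed.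

Hypothesis u_neq0 : forall n, u n != 0.
Hypothesis x_neq0 : forall n, x n != 0.

Let usq_gt0 n : 0 < u n ^+ 2. Proof. by rewrite exprn_even_gt0 ?u_neq0. Qed.

Let pusq_gt0 n : 0 < p n * u n ^+ 2.
Proof. by rewrite mulr_gt0 ?potential_gt0. Qed.

Let E_neq0 n : Ep n.+1 != 0.
Proof. by apply: contra_neq (x_neq0 n) => E0; rewrite /ul_x /ul_E E0 mul0r. Qed.

(** The flux lam_n pi_n (u_(n+1) - u_n) does not depend on n, and
    lam_n pi_n = mu_(n+1) pi_(n+1). *)
Lemma ul_three_term n :
  lam n.+1 * u n.+2 + mu n.+1 * u n = (lam n.+1 + mu n.+1) * u n.+1.
Proof.
rewrite [u n.+2]ul_uS [u n.+1 in LHS]ul_uS [u n.+1 in RHS]ul_uS potentialS.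
field.
by rewrite lam_neq0 p_neq0 mu_neq0 lam_neq0.
Qed.

Lemma ul_factorization :
  bd_matrix lam mu =2 imulmx (ul_AU lam mu x0 mut0) (ul_AL lam mu x0 mut0).
Proof.
have sup n : x n * s n.+1 = lam n.
  rewrite /ul_x /ul_s /ul_E; field.
  by rewrite ?E_neq0 ?p_neq0 ?u_neq0.
have sub n : y n.+1 * r n.+1 = mu n.+1.
  rewrite /ul_y /ul_r; field.
  by rewrite ?E_neq0 ?p_neq0 ?u_neq0.
have yS n : y n.+1 * s n.+1 = - (mu n.+1 * u n / u n.+1).
  rewrite /ul_y /ul_s /ul_E potentialS; field.
  by rewrite ?E_neq0 ?u_neq0 ?p_neq0 ?lam_neq0 ?mu_neq0.
have xr n : x n * r n.+1 = - (lam n * u n.+1 / u n).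
  rewrite /ul_x /ul_r /ul_E potentialS; field.
  by rewrite ?E_neq0 ?u_neq0 ?p_neq0 ?lam_neq0 ?mu_neq0.
have diag0 : y 0 * s 0 + x 0 * r 1 = - (lam 0%N + mu 0%N).
  rewrite xr ul_uS /ul_y ul_Epred0 ul_u0 potential0 /=; field.
  by rewrite lam_neq0.
(* The diagonal entry times u_(n+1) is the three-term recurrence. *)
have diagS n : y n.+1 * s n.+1 + x n.+1 * r n.+2 = - (lam n.+1 + mu n.+1).
  rewrite yS xr -[RHS](mulfK (u_neq0 n.+1)) mulNr -ul_three_term; field.
  exact: u_neq0.
move=> i j; rewrite imulmx_upper_bidiag /ul_AL /lower_bidiag /bd_matrix eqSS.
have [->|ne1] := eqVneq j i.+1.
  by rewrite !eqn_nearF mulr0 add0r sup.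
have [->|ne2] := eqVneq i j.+1.
  by rewrite !eqn_nearF mulr0 addr0 sub.
have [_|_] := eqVneq j i; last by rewrite !mulr0 addr0.
by case: i {ne1 ne2} => [|i]; rewrite ?diag0 ?diagS.
Qed.

(** A form of the death rates that treats index 1 like the others and shows
    their sign in terms of u and E. *)
Lemma darboux_muS n :
  darboux_mu lam mu x0 mut0 n.+1 = lam n * u n.+1 * Ep n / (u n * Ep n.+1).
Proof.
case: n => [|n] /=; first by rewrite ul_Epred0 ul_Epred1 ul_u0 mul1r mulrA.
rewrite /ul_x /ul_E potentialS; field.
by rewrite ?E_neq0 ?u_neq0 ?p_neq0 ?lam_neq0 ?mu_neq0.
Qed.

Lemma darboux_tridiagonal :
  darboux lam mu x0 mut0 =2
    bd_matrix (darboux_lam lam mu x0 mut0) (darboux_mu lam mu x0 mut0).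
Proof.
have sub n : r n.+1 * y n = darboux_mu lam mu x0 mut0 n.+1.
  rewrite darboux_muS /ul_r /ul_y potentialS; field.
  by rewrite ?E_neq0 ?u_neq0 ?p_neq0 ?lam_neq0 ?mu_neq0.
have sup0 : s 0 * x 0 = darboux_lam lam mu x0 mut0 0 by rewrite mul1r ul_x0.
have supS n : s n.+1 * x n.+1 = darboux_lam lam mu x0 mut0 n.+1.
  rewrite /ul_s /darboux_lam /ul_x /ul_E; field.
  by rewrite ?E_neq0 ?u_neq0 ?p_neq0 ?lam_neq0 ?mu_neq0.
have diag0 : s 0 * y 0 = - (darboux_lam lam mu x0 mut0 0 + mut0).
  by rewrite mul1r /ul_y ul_Epred0 ul_u0 potential0 mulr1 divr1.
have diagS n : s n.+1 * y n.+1 + r n.+1 * x n =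
    - (darboux_lam lam mu x0 mut0 n.+1 + darboux_mu lam mu x0 mut0 n.+1).
  rewrite -supS -sub /ul_s /ul_x /ul_y /ul_r /ul_E.
  (* With the E on both sides expressed through the same E_n, the two
     corrections in mut0 coming from the birth and death rates cancel. *)
  rewrite (_ : Ep n = Ep n.+1 + mut0 * (p n * u n ^+ 2)); last first.
    by rewrite ul_EpredS subrK.
  rewrite [Ep n.+2]ul_EpredS potentialS; field.
  by rewrite ?E_neq0 ?u_neq0 ?p_neq0 ?lam_neq0 ?mu_neq0.
move=> i j; rewrite /darboux /bd_matrix.
case: i => [|i]; rewrite ?imulmx_lower_bidiag0 ?imulmx_lower_bidiagS.
  by rewrite /ul_AU /upper_bidiag; case: j => [|[|j]] //=; rewrite mulr0.
rewrite /ul_AU /upper_bidiag eqSS; have [->|ne1] := eqVneq j i.+2.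
  by rewrite !eqn_nearF mulr0 addr0 supS.
have [->|ne2] := eqVneq j i.+1.
  by rewrite !eqn_nearF diagS.
have [_|_] := eqVneq j i; last by rewrite !mulr0 addr0.
by rewrite mulr0 add0r sub.
Qed.

(** Positive rates only fix the sign of u_n E_n and of E_(n-1) E_(n+1); it is
    the two initial values E_(-1) = x0 + mut0 and E_0 = x0 that make all the
    signs positive. *)
Lemma darboux_rates_iff :
  bd_rates (darboux_lam lam mu x0 mut0) (darboux_mu lam mu x0 mut0) <->
  [/\ 0 < x0, 0 <= mut0, forall n, 0 < Ep n & forall n, 0 < u n].
Proof.
have pu_gt0 n : 0 < u n -> 0 < p n * u n.
  by move=> u_gt0; rewrite mulr_gt0// potential_gt0.
split=> [[lam'_gt0 mu'_gt0 mut0_ge0]|[x0_gt0 mut0_ge0 E_gt0 u_gt0]]; last first.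
  have x_gt0 n : 0 < x n by rewrite /ul_x divr_gt0 ?pu_gt0 ?E_gt0.
  split=> // [[|n]|n]; first exact: x0_gt0.
    by rewrite /= mulr_gt0// divr_gt0.
  by rewrite darboux_muS divr_gt0 ?mulr_gt0.
have x0_gt0 : 0 < x0 := lam'_gt0 0%N.
have x_gt0 n : 0 < x n.
  elim: n => [|n IHn]; first by rewrite ul_x0.
  by have := lam'_gt0 n.+1; rewrite /= pmulr_rgt0// pmulr_lgt0// invr_gt0.
have uE_gt0 n : 0 < u n * Ep n.+1.
  have -> : u n * Ep n.+1 = x n * (p n * u n ^+ 2).
    by rewrite /ul_x /ul_E; field; rewrite u_neq0 p_neq0.
  by rewrite mulr_gt0.
have EE_gt0 n : 0 < Ep n * Ep n.+2.
  have -> : Ep n * Ep n.+2 = darboux_mu lam mu x0 mut0 n.+1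
      * (u n * Ep n.+1) * (u n.+1 * Ep n.+2) / (lam n * u n.+1 ^+ 2).
    by rewrite darboux_muS; field; rewrite ?E_neq0 ?u_neq0 ?lam_neq0.
  by rewrite divr_gt0 ?(mulr_gt0 (lam_gt0 n)) ?(mulr_gt0 (mulr_gt0 _ _)).
have E_gt0 n : 0 < Ep n /\ 0 < Ep n.+1.
  elim: n => [|n [En_gt0 En1_gt0]].
    by rewrite ul_Epred1 ul_Epred0 ltr_wpDr.
  by split=> //; rewrite -(pmulr_rgt0 _ En_gt0).
split=> // n; first by have [] := E_gt0 n.
by rewrite -(pmulr_lgt0 _ (E_gt0 n).2).
Qed.

Lemma ul_u_gt0P : (forall n, 0 < u n) <->
  ((x0 + mut0)%:E <= (mu 0%N)%:E + (sum_A lam mu)^-1)%E.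
Proof.
have f_gt0 n : 0 < (lam n * p n)^-1.
  by rewrite invr_gt0 mulr_gt0// potential_gt0.
rewrite addeC -leeBlDr// -EFinB lee_fin_inv; last first.
  by apply: nneseries_ge0 => n _ _; rewrite lee_fin ltW.
apply: (iff_trans _ (partial_sums_ltP _ f_gt0 ltr01)).
by split=> h n; have := h n; rewrite /ul_u => ?; lra.
Qed.

Lemma ul_Epred_gt0P : 0 < x0 -> 0 <= mut0 -> (forall n, 0 < Ep n) <->
  (mut0%:E * sum_T lam mu x0 mut0 <= (x0 + mut0)%:E)%E.
Proof.
move=> x0_gt0 mut0_ge0.
apply: (iff_trans _ (partial_sums_ltP _ pusq_gt0 _)); last by rewrite ltr_wpDr.
by split=> h n; have := h n; rewrite /ul_Epred subr_gt0.
Qed.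

Lemma sum_T_gt1 : (1%:E < sum_T lam mu x0 mut0)%E.
Proof.
apply: (@lt_le_trans _ _ (\sum_(0 <= n < 2) (p n * u n ^+ 2)%:E)%E).
  rewrite !big_nat_recr //= big_nil add0e potential0 ul_u0 -EFinD lte_fin.
  by rewrite expr1n mulr1 ltrDl pusq_gt0.
by apply: nneseries_lim_ge => n _ _; rewrite lee_fin ltW.
Qed.

End ULFactorization.

Theorem theorem3p9 (R : realType) (A : imatrix R) (lam mu : nat -> R)
    (hA : is_bd_generator A lam mu)
    (x0 mut0 : R) (hx0 : x0 != 0) (hmut0 : 0 <= mut0)
    (hu : forall n, ul_u lam mu x0 mut0 n != 0)
    (hx : forall n, ul_x lam mu x0 mut0 n != 0) :
  let T := sum_T lam mu x0 mut0 in
  let sA := sum_A lam mu in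
  [/\ A =2 imulmx (ul_AU lam mu x0 mut0) (ul_AL lam mu x0 mut0),
      (1%:E < T)%E
    & is_bd_generator (darboux lam mu x0 mut0)
        (darboux_lam lam mu x0 mut0) (darboux_mu lam mu x0 mut0)
      <->
      [/\ T = +oo%E, mut0 = 0, 0 < x0 & (x0%:E <= (mu 0%N)%:E + sA^-1)%E]
      \/
      [/\ (T < +oo)%E, 0 < x0, 0 <= mut0,
          (mut0%:E * T <= (x0 + mut0)%:E)%E
        & ((x0 + mut0)%:E <= (mu 0%N)%:E + sA^-1)%E] ].
Proof.
move=> T sA; case: hA => rates A_eq.
have T_gt1 : (1%:E < T)%E by exact: sum_T_gt1.
split=> //.
  by move=> i j; rewrite A_eq -ul_factorization.
(* The two situations are one condition: when T is infinite, a finite bound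
   on mut0 * T means mut0 = 0, by the convention 0 * +oo = 0. *)
have bdP : is_bd_generator (darboux lam mu x0 mut0)
    (darboux_lam lam mu x0 mut0) (darboux_mu lam mu x0 mut0) <->
  [/\ 0 < x0, (mut0%:E * T <= (x0 + mut0)%:E)%E
    & ((x0 + mut0)%:E <= (mu 0%N)%:E + sA^-1)%E].
  split=> [[/darboux_rates_iff[]// x0_gt0 _ /ul_Epred_gt0P E_le]|].
    move=> /ul_u_gt0P u_le _.
    by split=> //; [exact: E_le|exact: u_le].
  case=> x0_gt0 E_le u_le; split; last exact: darboux_tridiagonal.
  apply/darboux_rates_iff => //; split=> //; last exact/ul_u_gt0P.
  exact/ul_Epred_gt0P.
apply: (iff_trans bdP); split=> [[x0_gt0 E_le u_le]|]; last first.
  case=> [[_ mut0_eq0 x0_gt0 u_le]|[]//].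
  by split=> //; rewrite mut0_eq0 ?mul0e addr0// lee_fin ltW.
have [T_fin|] := ltP T +oo%E; first by right.
rewrite leye_eq => /eqP T_oo; left.
have mut0_eq0 : mut0 = 0.
  apply/eqP; rewrite eq_le hmut0 andbT leNgt; apply/negP => mut0_gt0.
  by move: E_le; rewrite T_oo gt0_muley.
by split=> //; rewrite mut0_eq0 addr0 in u_le.
Qed.
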